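(* Let $f:M\to M$ be a continuous map on a compact, finite-dimensional manifold $M$, let $\mu$ be an $f$-invariant Borel probability measure, and let $\Phi=\{\phi_n\}_{n\ge 1}$ be a subadditive potential on $M$. If the growth rates of $\Phi$ satisfy $$\Phi^*(x):=\lim_{n\to\infty}\frac1n\phi_n(x)<0\quad\text{for }\mu\text{-a.e. }x\in M,$$ then there exists $\epsilon>0$ such that $\widehat\Phi^*(x)<0$ for each point $x\in A_\epsilon(\mu)$.
   Context: $\mathcal M$ denotes the set of all Borel probability measures on $M$ with the weak$^*$ topology, and $\mathrm{dist}^*$ is a fixed metric on $\mathcal M$ inducing this topology. For $\mu\in\mathcal M$ and $\epsilon>0$, $\mathcal N_\epsilon(\mu)$ is the $\epsilon$-neighborhood of $\mu$ in the metric $\mathrm{dist}^*$. For $x\in M$, the empirical measures are $\delta_{x,n}=\frac1n\sum_{j=0}^{n-1}\delta_{f^j(x)}$, where $\delta_y$ is the Dirac measure at $y$. $\mathcal V_f(x)$ is the set of all weak$^*$ limits of convergent subsequences of $(\delta_{x,n})_{n\ge1}$. The basin of $\epsilon$-attraction of $\mu$ is $A_\epsilon(\mu)=\{x\in M:\mathcal V_f(x)\cap\mathcal N_\epsilon(\mu)\neq\emptyset\}$. A subadditive potential on $M$ is a sequence $\Phi=\{\phi_n\}_{n\ge1}$ of continuous real functions on $M$ with $\phi_{n+m}(x)\le\phi_n(x)+\phi_m(f^n x)$ for all $x\in M$ and $n,m\in\mathbb N$ (positive integers). By Kingman's subadditive ergodic theorem the limit $\Phi^*(x)$ exists (possibly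 $-\infty$) for $\mu$-a.e. $x$, for every $f$-invariant probability $\mu$. The smallest growth rate at any $x\in M$ is $\widehat\Phi^*(x):=\liminf_{n\to\infty}\frac1n\phi_n(x)$. *)

(* Defs.v *)
From HB Require Import structures.
From mathcomp Require Import all_boot all_order all_algebra.
From mathcomp Require Import all_classical all_reals all_analysis.

Set Implicit Arguments.
Unset Strict Implicit.
Unset Printing Implicit Defensive.

Import Order.TTheory GRing.Theory Num.Def Num.Theory.
Import numFieldNormedType.Exports.

Local Open Scope classical_set_scope.
Local Open Scope ring_scope.

(* Topological manifold of dimension [d], without boundary: Hausdorff, second
   countable, and every point has an open neighbourhood [U] homeomorphic
   (by [g], with inverse [h]) to an open subset [V] of R^d. *)
Definition is_manifold (R : realType) (d : nat) (M : topologicalType) : Prop :=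
  [/\ hausdorff_space M,
      @second_countable M &
      forall x : M, exists (U : set M) (V : set 'rV[R]_d)
          (g : M -> 'rV[R]_d) (h : 'rV[R]_d -> M),
        [/\ [/\ open U, U x & open V],
            set_fun U V g /\ set_fun V U h,
            {in U, cancel g h} /\ {in V, cancel h g} &
            {within U, continuous g} /\ {within V, continuous h}]].

(* [M] is a pointed type because the library requires it of measurable types;
   the base point only says that [M] is nonempty, as it must be in order to
   carry a probability measure. *)
Definition borel (M : ptopologicalType) : measurableType (@open M).-sigma :=
  g_sigma_algebraType (@open M).

Section WeakStar.
Context (M : ptopologicalType) (R : realType).

Definition integral_ev (mu : probability (borel M) R) :
    {ptws continuousType M R -> R} :=
  fun phi => Rintegral mu setT phi.

(* The weak* topology: the coarsest one for which mu |-> \int phi dmu is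
   continuous for each continuous phi : M -> R. *)
Definition weakstar : topologicalType := initial_topology integral_ev.

Definition invariant_measure (f : M -> M) (mu : probability (borel M) R) :
    Prop :=
  forall A : set (borel M), measurable A -> mu (f @^-1` A) = mu A.

(* A library measure is a function on all subsets of [M], with unconstrained
   values on the non-measurable ones. Two probability measures are therefore
   identified when they agree on Borel sets, and a metric separates
   points up to this identification. *)
Record weakstar_metric (dist : weakstar -> weakstar -> R) : Prop := {
  wdist_ge0 : forall mu nu, 0 <= dist mu nu ;
  wdist_eq0 : forall mu nu : probability (borel M) R,
    dist mu nu = 0 <-> (forall A, measurable A -> mu A = nu A) ;
  wdist_sym : forall mu nu, dist mu nu = dist nu mu ;
  wdist_triangle : forall mu nu xi, dist mu xi <= dist mu nu + dist nu xi ;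
  wdist_nbhs : forall (mu : weakstar) (U : set weakstar),
    nbhs mu U <-> exists2 e : R, 0 < e & [set nu | dist mu nu < e] `<=` U }.

Definition eps_nbhd (dist : weakstar -> weakstar -> R) (eps : R)
    (mu : weakstar) : set weakstar :=
  [set nu | dist mu nu < eps].

Section Empirical.
Variables (f : M -> M) (x : M) (n : nat).

(* Indices are shifted: this is delta_{x, n + 1}. *)
Definition empirical : set (borel M) -> \bar R :=
  mscale (n.+1%:R^-1)%:nng
    (msum (fun j => @dirac _ (borel M) (iter j f x) R) n.+1).

HB.instance Definition _ := Measure.on empirical.

Let empirical_setT : empirical setT = 1%E.
Proof.
transitivity ((n.+1%:R^-1)%:E *
    \sum_(j < n.+1) @dirac _ (borel M) (iter j f x) R setT)%E => //.
under eq_bigr do rewrite diracT.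
by rewrite sumEFin -EFinM sumr_const card_ord mulVf.
Qed.

HB.instance Definition _ :=
  Measure_isProbability.Build _ _ _ empirical empirical_setT.

End Empirical.

Definition limit_measures (f : M -> M) (x : M) : set weakstar :=
  [set nu | exists2 k : nat -> nat, {homo k : i j / (i < j)%N} &
     (fun i => (empirical f x (k i) : probability (borel M) R) : weakstar)
       @ \oo --> nu].

Definition basin (dist : weakstar -> weakstar -> R) (f : M -> M) (eps : R)
    (mu : weakstar) : set M :=
  [set x | limit_measures f x `&` eps_nbhd dist eps mu !=set0].

(* Only the terms [phi n] with [0 < n] are meaningful. *)
Record subadditive_potential (f : M -> M) (phi : nat -> M -> R) : Prop := {
  potential_continuous : forall n, (0 < n)%N -> continuous (phi n) ;
  potential_subadditive : forall n m x, (0 < n)%N -> (0 < m)%N ->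
    phi (n + m)%N x <= phi n x + phi m (iter n f x) }.

(* The junk term at n = 0 affects neither the limit nor the liminf. *)
Definition growth (phi : nat -> M -> R) (x : M) : (\bar R)^nat :=
  fun n => (n%:R^-1 * phi n x)%:E.

Definition growth_rate (phi : nat -> M -> R) (x : M) : \bar R :=
  limn (growth phi x).

Definition lower_growth_rate (phi : nat -> M -> R) (x : M) : \bar R :=
  limn_einf (growth phi x).

End WeakStar.

(* Main.v *)
(* The functions phi_n / n are uniformly bounded above by max |phi_1|, so the
   reverse Fatou lemma turns Phi^* < 0 a.e. into \int phi_N dmu < 0 for some N
   (Kingman's theorem is not needed: convergence is part of the hypothesis).
   This inequality is weak*-open, hence it holds for every nu close to mu. If
   nu is a limit of empirical measures of x, the Birkhoff averages of phi_N
   along the orbit of x are infinitely often below (1/2) \int phi_N dnu < 0.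
   Finally phi_{n+N}(x) - phi_n(x) <= phi_N (f^n x), and telescoping bounds
   phi_n(x) + ... + phi_{n+N-1}(x) by a constant plus the Birkhoff sum of
   phi_N, so that some term of this window is at most linear in n with a
   negative slope. *)

Require Import Defs.
From HB Require Import structures.
From mathcomp Require Import all_boot all_order all_algebra.
From mathcomp Require Import all_classical all_reals all_analysis.
From mathcomp Require Import measurable_realfun ring lra zify.

Set Implicit Arguments.
Unset Strict Implicit.
Unset Printing Implicit Defensive.

Import Order.TTheory GRing.Theory Num.Def Num.Theory.
Import numFieldNormedType.Exports.

Local Open Scope classical_set_scope.
Local Open Scope ring_scope.

(** * Weak* continuity of integration *)

Lemma integral_ev_continuous (M : ptopologicalType) (R : realType)
  (phi : continuousType M R) :
  continuous (fun nu : weakstar M R => integral_ev nu phi).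
Proof.
move=> nu; apply: (@continuous_comp _ _ _
  (@integral_ev M R : weakstar M R -> _) (fun g => g phi)).
  exact: initial_continuous.
by have := @proj_continuous (continuousType M R) (fun=> R) phi; exact.
Qed.

Lemma integral_continuous (M : ptopologicalType) (R : realType)
  (phi : M -> R) : continuous phi ->
  continuous (fun nu : weakstar M R =>
    Rintegral (nu : probability (borel M) R) setT phi).
Proof.
move=> cphi.
exact: (@integral_ev_continuous _ _ (mkcts cphi : continuousType M R)).
Qed.

(** * Integrals against probability measures *)

Section probability_integral.
Context {d} {T : measurableType d} {R : realType} (P : probability T R).
Local Open Scope ereal_scope.

Lemma probability_integral_cst (c : R) : \int[P]_x c%:E = c%:E.
Proof. by rewrite integral_cst// [X in _ * X]probability_setT mule1. Qed.

(** Almost everywhere [g] is [c + |g - c|], a sum of nonnegative functions even where [g] is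
    infinite. If the integral were at most [c], that of [|g - c|] would vanish, forcing [g = c]
    almost everywhere. *)
Lemma ge0_integral_gt_cst (g : T -> \bar R) (c : R) :
  measurable_fun setT g -> (forall x, 0 <= g x) -> (0 <= c)%R ->
  {ae P, forall x, c%:E < g x} -> c%:E < \int[P]_x g x.
Proof.
move=> mg g0 c0 cg.
have mgc : measurable_fun setT (fun x => g x - c%:E).
  by apply: emeasurable_funB.
have intE : \int[P]_x g x = c%:E + \int[P]_x `|g x - c%:E|.
  transitivity (\int[P]_x (c%:E + `|g x - c%:E|)); last first.
    rewrite ge0_integralD//; last exact: measurableT_comp.
    by rewrite probability_integral_cst.
  apply: ge0_ae_eq_integral => //.
  - by apply: emeasurable_funD => //; exact: measurableT_comp.
  - by move=> x _; rewrite adde_ge0.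
  - apply: filterS cg => x cgx _.
    have -> : `|g x - c%:E| = g x - c%:E.
      by apply: gee0_abs; rewrite sube_ge0//; exact: ltW.
    by rewrite addeC subeK.
rewrite ltNge; apply/negP => gc.
have : \int[P]_x `|g x - c%:E| = 0.
  apply/eqP; rewrite eq_le integral_ge0// andbT.
  by rewrite -(@leeD2lE _ c%:E)// -intE adde0.
move/(ae_eq_integral_abs P measurableT mgc) => gc0.
(* Since [P] has mass 1, two properties that hold almost everywhere hold together at some point. *)
have PP : ProperFilter (almost_everywhere P).
  apply: ae_properfilter_algebraOfSetsType.
  by rewrite [X in _ < X]probability_setT.
have [x [cgx /(_ Logic.I)/= gcx]] := filter_ex (filterI cg gc0).
by move: cgx; rewrite -sube_gt0 gcx ltxx.
Qed.
End probability_integral.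

Lemma continuous_borel_measurable (M : ptopologicalType) (R : realType)
  (phi : M -> R) : continuous phi ->
  measurable_fun setT (phi : borel M -> R).
Proof.
move=> /continuousP cphi.
apply: (measurability _ (RGenOpens.measurableE R)) => _ [_ [a [b ->] <-]].
by rewrite setTI; apply: sub_sigma_algebra; exact/cphi/interval_open.
Qed.

Lemma compact_continuous_bound (M : ptopologicalType) (R : realType)
  (phi : M -> R) : compact [set: M] -> continuous phi ->
  exists2 C : R, 0 <= C & forall x, `|phi x| <= C.
Proof.
move=> cM cphi; have M0 : [set: M] !=set0 by exists point.
have cnorm : {within [set: M], continuous (fun x => `|phi x|)}.
  apply: continuous_subspaceT => x.
  by apply: continuous_comp; [exact: cphi|exact: norm_continuous].
have [c _ maxc] := compact_EVT_max M0 cM cnorm.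
by exists `|phi c| => // x; apply: maxc; rewrite inE.
Qed.

Lemma compact_continuous_integrable (M : ptopologicalType) (R : realType)
  (P : probability (borel M) R) (phi : M -> R) :
  compact [set: M] -> continuous phi -> P.-integrable setT (EFin \o phi).
Proof.
move=> cM cphi; have [C C0 phiC] := compact_continuous_bound cM cphi.
apply: measurable_bounded_integrable => //.
- by rewrite [X in (X < _)%E]probability_setT ltry.
- exact: continuous_borel_measurable.
- exists C; split; first exact: ger0_real.
  by move=> D CD x _ /=; rewrite (le_trans (phiC x))// ltW.
Qed.

Lemma Rintegral_empirical (M : ptopologicalType) (R : realType) (f : M -> M)
  (x : M) (n : nat) (phi : M -> R) : compact [set: M] -> continuous phi ->
  Rintegral (empirical R f x n : probability (borel M) R) setT phi
  = n.+1%:R^-1 * \sum_(j < n.+1) phi (iter j f x).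
Proof.
move=> cM cphi; have [C C0 phiC] := compact_continuous_bound cM cphi.
have mphi := continuous_borel_measurable cphi.
have iphi := compact_continuous_integrable (empirical R f x n) cM cphi.
(* Additivity of the integral in the measure is applied to nonnegative integrands; adding the bound
   [C] to [phi] reduces to that case. *)
have mE (psi : borel M -> R) :
    measurable_fun setT psi -> (forall y, 0 <= psi y) ->
    Rintegral (empirical R f x n : probability (borel M) R) setT psi =
    n.+1%:R^-1 * \sum_(j < n.+1) psi (iter j f x).
  move=> mpsi psi0; rewrite /Rintegral.
  rewrite ge0_integral_mscale//;
    [|exact/measurable_EFinP|by move=> y _; rewrite lee_fin].
  rewrite ge0_integral_measure_sum//;
    [|by move=> y _; rewrite lee_fin|exact/measurable_EFinP].
  under eq_bigr => j _.
    rewrite integral_dirac//; last exact/measurable_EFinP.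
    rewrite diracT mul1e; over.
  by rewrite sumEFin.
have iC : (empirical R f x n : probability (borel M) R).-integrable setT
    (EFin \o cst C).
  by apply: compact_continuous_integrable => //; exact: cst_continuous.
have := mE (fun y => phi y + C).
rewrite RintegralD//.
rewrite [X in _ + X]/Rintegral probability_integral_cst/=.
rewrite big_split/= mulrDr sumr_const card_ord -(mulr_natl C) mulKf//.
move=> /(_ _ _)/addIr; apply; first exact: measurable_funD.
by move=> y; rewrite -lerBlDr sub0r (le_trans _ (lerNnormlW (phiC y))).
Qed.

(** * Subadditivity along a single orbit *)

(* Shifting the window by one replaces [phi n.+1] by [phi (n.+1 + N)]. *)
Lemma window_sum_le (M : ptopologicalType) (R : realType) (f : M -> M)
  (phi : nat -> M -> R) (N n : nat) (x : M) :
  subadditive_potential f phi -> (0 < N)%N ->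
  \sum_(i < N) phi (n.+1 + i)%N x <=
  \sum_(i < N) phi i.+1 x + \sum_(j < n) phi N (iter j.+1 f x).
Proof.
move=> sphi N0; elim: n => [|n IH]; first by rewrite big_ord0 addr0.
rewrite big_ord_recr/= addrA; apply: (le_trans _ (lerD IH (lexx _))).
(* The same sum is split at its first term on the left and at its last on the right, which relates
   two consecutive windows. *)
have : \sum_(i < N.+1) phi (n.+1 + i)%N x =
    \sum_(i < N.+1) phi (n.+1 + i)%N x by [].
rewrite {1}big_ord_recl big_ord_recr/= addn0.
under eq_bigr do rewrite /bump/= addnA addn1.
have := potential_subadditive sphi x (ltn0Sn n) N0.
by rewrite /=; lra.
Qed.

Lemma lower_growth_rate_lt0 (M : ptopologicalType) (R : realType) (f : M -> M)
  (phi : nat -> M -> R) (N : nat) (c : R) (x : M) :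
  subadditive_potential f phi -> (0 < N)%N -> 0 < c ->
  (forall n0, exists2 n, (n0 <= n)%N &
    \sum_(j < n.+1) phi N (iter j f x) <= - c * n.+1%:R) ->
  (lower_growth_rate phi x < 0)%E.
Proof.
move=> sphi N0 c0 often.
have NR0 : 0 < N%:R :> R by rewrite ltr0n.
(* The slope [c] loses a factor 2 to absorb the constant [K], a factor [N] in selecting one term of
   the window, and a factor 2 because the index of that term is at most [2 * n.+1]. *)
have dN : 0 < c / (4 * N%:R) by rewrite divr_gt0// mulr_gt0.
suff le_often m0 : exists2 m, (m0 <= m)%N &
    m%:R^-1 * phi m x <= - (c / (4 * N%:R)).
  rewrite /lower_growth_rate limn_einf_lim.
  apply: (@le_lt_trans _ _ (- (c / (4 * N%:R)))%:E);
    last by rewrite lte_fin oppr_lt0.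
  apply: lime_le; first exact: is_cvg_einfs.
  apply: nearW => m0; have [m m0m phim] := le_often m0.
  apply: (@le_trans _ _ (growth phi x m)); last by rewrite lee_fin.
  by apply: ereal_inf_lbound; exists m.
(* The term [phi N x] is subtracted because the sum in [window_sum_le] starts at [f x], whereas the
   Birkhoff sum starts at [x]. *)
pose K := \sum_(i < N) phi i.+1 x - phi N x.
pose k0 := (Num.truncn (`|K| / (c / 2))).+1.
have [n n_ge Sn] := often (maxn m0 (maxn N k0)).
have n1 : 0 < n.+1%:R :> R by rewrite ltr0n.
have Kn : K <= c / 2 * n.+1%:R.
  rewrite (le_trans (ler_norm _))// mulrC -ler_pdivrMr; last lra.
  rewrite (le_trans (ltW (truncnS_gt _)))// ler_nat.
  by rewrite (leq_trans _ (leqW n_ge))// !leq_max leqnn !orbT.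
have Un : \sum_(i < N) phi (n.+1 + i)%N x <= - (c / 2) * n.+1%:R.
  have := window_sum_le n x sphi N0.
  have : phi N x + \sum_(j < n) phi N (iter j.+1 f x) <= - c * n.+1%:R.
    by move: Sn; rewrite big_ord_recl.
  by move: Kn; rewrite /K; lra.
have [i phi_i] : exists i : 'I_N,
    phi (n.+1 + i)%N x <= - (c / 2) * n.+1%:R / N%:R.
  apply: contrapT => /forallNP no.
  move: Un; apply/negP; rewrite -ltNge.
  rewrite [ltLHS](_ : _ = \sum_(i < N) (- (c / 2) * n.+1%:R / N%:R));
    last first.
    by rewrite sumr_const card_ord -[RHS]mulr_natr mulfVK// gt_eqF.
  apply: ltr_sum => [|j _]; first by apply/hasP;
    exists (Ordinal N0); rewrite ?mem_index_enum.
  by rewrite ltNge; apply/negP/no.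
have m2 : (n.+1 + i)%:R <= 2 * n.+1%:R :> R.
  by rewrite -natrM ler_nat; have := ltn_ord i; move: n_ge; lia.
exists (n.+1 + i)%N; first by move: n_ge; lia.
rewrite mulrC ler_pdivrMr ?ltr0n//; apply: (le_trans phi_i).
rewrite -mulrA [_ / N%:R]mulrC.
have -> : - (c / 2) * (N%:R^-1 * n.+1%:R) = - (c / (4 * N%:R) * (2 * n.+1%:R)).
  by field; rewrite gt_eqF.
by rewrite mulNr lerN2 ler_pM2l.
Qed.

(** * A negative integral from negative growth rates *)

Lemma potential_le (M : ptopologicalType) (R : realType) (f : M -> M)
  (phi : nat -> M -> R) (C : R) (n : nat) (x : M) :
  subadditive_potential f phi -> (forall y, phi 1%N y <= C) ->
  phi n.+1 x <= C * n.+1%:R.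
Proof.
move=> sphi phi1; elim: n x => [|n IH] x; first by rewrite mulr1.
have := potential_subadditive sphi x (ltn0Sn n) (ltn0Sn 0).
rewrite addn1 => /le_trans; apply.
by rewrite -[in leRHS]natr1 mulrDr mulr1 lerD.
Qed.

(* Reverse Fatou: the functions [phi n / n] are uniformly bounded above. *)
Lemma exists_integral_lt0 (M : ptopologicalType) (R : realType) (f : M -> M)
  (phi : nat -> M -> R) (mu : probability (borel M) R) :
  compact [set: M] -> subadditive_potential f phi ->
  {ae mu, forall x, cvgn (growth phi x) /\ (growth_rate phi x < 0)%E} ->
  exists2 N, (0 < N)%N & Rintegral mu setT (phi N) < 0.
Proof.
move=> cM sphi phi_neg; apply: contrapT => /forall2NP no.
have int_ge0 n : (0 < n)%N -> 0 <= Rintegral mu setT (phi n).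
  by move=> n0; case: (no n) => // /negP; rewrite -leNgt.
have [C C0 phiC] := compact_continuous_bound cM
  (potential_continuous sphi (ltn0Sn 0)).
have phi1 y : phi 1%N y <= C := le_trans (ler_norm _) (phiC y).
(* Subtracting from the upper bound [C] gives nonnegative functions, as Fatou's lemma requires; the
   shift to [n.+1] skips the junk term at 0. *)
pose F n (x : borel M) : \bar R := (C - n.+1%:R^-1 * phi n.+1 x)%:E.
have cphi n : continuous (phi n.+1) := potential_continuous sphi (ltn0Sn n).
have iphi n : mu.-integrable setT (EFin \o phi n.+1).
  exact: compact_continuous_integrable.
have mF n : measurable_fun setT (F n).
  apply/measurable_EFinP/measurable_funB => //; apply: measurable_funM => //.
  exact: continuous_borel_measurable.
have F0 n (x : borel M) : [set: borel M] x -> (0 <= F n x)%E.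
  move=> _; rewrite lee_fin subr_ge0 mulrC ler_pdivrMr ?ltr0n//.
  exact: potential_le sphi phi1.
(* The contrary assumption enters here, through [int_ge0]. *)
have intF n : (\int[mu]_x F n x <= C%:E)%E.
  have iG : mu.-integrable setT (EFin \o (fun x => n.+1%:R^-1 * phi n.+1 x)).
    by have := integrableZl measurableT n.+1%:R^-1 (iphi n).
  rewrite integralB_EFin//; last exact: finite_measure_integrable_cst.
  rewrite probability_integral_cst.
  rewrite -[X in (_ - X)%E]fineK; last exact: integrable_fin_num.
  rewrite -EFinB lee_fin lerBlDr lerDl -/(Rintegral _ _ _) RintegralZl//.
  by rewrite mulr_ge0// int_ge0.
have mlim : measurable_fun setT (fun x => limn_einf (F^~ x)).
  apply: measurableT_comp => //; apply: measurable_fun_limn_esup => n.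
  exact: measurableT_comp.
have lim_ge0 x : (0 <= limn_einf (F^~ x))%E.
  rewrite limn_einf_lim; apply: lime_ge; first exact: is_cvg_einfs.
  by apply: nearW => n; apply: le_ereal_inf_tmp => _ [m _ <-]; exact: F0.
have lim_gt : {ae mu, forall x, (C%:E < limn_einf (F^~ x))%E}.
  apply: (@filterS _ _ (ae_filter_ringOfSetsType mu) _ _ _ phi_neg).
  move=> x [cvg_x lt0_x].
  have cvgS : (fun n => growth phi x n.+1) @ \oo --> growth_rate phi x.
    by rewrite (cvg_shiftS (growth phi x)).
  (* The growth rate may be [-oo]; the difference makes sense because [C] is finite. *)
  have cvgF : F^~ x @ \oo --> (C%:E - growth_rate phi x)%E.
    exact: cvgeB (fin_num_adde_defr _ _) (cvg_cst _) cvgS.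
  rewrite (cvg_limn_einf_sup cvgF).1 -[ltLHS]adde0 lteD2lE//.
  by rewrite oppe_gt0.
(* The integral of the lower limit exceeds [C], while Fatou's lemma and [intF] bound it by [C]. *)
have := ge0_integral_gt_cst mlim lim_ge0 C0 lim_gt.
apply/negP; rewrite -leNgt (le_trans (fatou mu measurableT mF F0))//.
rewrite limn_einf_lim; apply: lime_le; first exact: is_cvg_einfs.
apply: nearW => n; apply: le_trans (intF n).
by apply: ereal_inf_lbound; exists n => /=.
Qed.

Theorem theorem2p11 (R : realType) (d : nat) (M : ptopologicalType)
  (M_manifold : is_manifold R d M) (M_compact : compact [set: M])
  (dist : weakstar M R -> weakstar M R -> R)
  (dist_metric : weakstar_metric dist)
  (f : M -> M) (f_cont : continuous f)
  (mu : probability (borel M) R) (mu_inv : invariant_measure f mu)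
  (phi : nat -> M -> R) (phi_sub : subadditive_potential f phi)
  (phi_neg : {ae mu, forall x,
     cvgn (growth phi x) /\ (growth_rate phi x < 0)%E}) :
  exists2 eps : R, 0 < eps &
    forall x : M, basin dist f eps mu x -> (lower_growth_rate phi x < 0)%E.
Proof.
have [N N0 muN] := exists_integral_lt0 M_compact phi_sub phi_neg.
have cN := potential_continuous phi_sub N0.
have cint := integral_continuous cN.
have [eps eps0 sub] : exists2 e : R, 0 < e & [set nu | dist mu nu < e] `<=`
    [set nu : weakstar M R |
      Rintegral (nu : probability (borel M) R) setT (phi N) < 0].
  apply/(wdist_nbhs dist_metric (mu : weakstar M R)).
  exact: (cvgr_lt _ (cint mu) _ muN).
exists eps => // x [nu [[k k_mono nu_lim] nu_eps]].
pose I := Rintegral (nu : probability (borel M) R) setT (phi N).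
have I_lt0 : I < 0 := sub _ nu_eps.
(* Along the subsequence the Birkhoff averages tend to [I < 0], so they are eventually below
   [I / 2]. *)
apply: (@lower_growth_rate_lt0 _ _ f _ N (- I / 2) _ phi_sub N0); first lra.
move=> n0.
have : \forall i \near \oo, Rintegral
    (empirical R f x (k i) : probability (borel M) R) setT (phi N) < I / 2.
  apply: (cvgr_lt I); last by lra.
  exact: (cvg_comp _ _ nu_lim (cint nu)).
move=> [i0 _ lt_i].
(* A strictly increasing [k] dominates the identity, so [k] reaches beyond any [n0]. *)
have k_ge i : (i <= k i)%N.
  by elim: i => // i IH; rewrite (leq_ltn_trans IH)// k_mono.
exists (k (maxn i0 n0)); first by rewrite (leq_trans _ (k_ge _))// leq_maxr.
have /= := lt_i (maxn i0 n0) (leq_maxl _ _).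
rewrite Rintegral_empirical// mulrC ltr_pdivrMr ?ltr0n// => /ltW.
by rewrite [- I / 2]mulNr opprK.
Qed.
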